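(* Let $D\subset\mathbb{C}^n$ be a central hyperplane arrangement with reduced defining equation $f$ (a product of pairwise non-proportional linear forms), with irreducible components (hyperplanes) $D_i$. For a rational number $\alpha>0$ let $m_\alpha$ be the multiplicity of $\alpha$ as a root of $b_f(-s)$ (with $m_\alpha=0$ if $\alpha$ is not a root), and put $\lambda=\exp(-2\pi i\alpha)$. Then $m_\alpha\le m(\lambda)$. In particular, the set $R_f$ of roots of $b_f(-s)$ satisfies $R_f\subset\bigcup_{L\in\mathcal{DE}(D)}\mathbb{Z}\,m_L^{-1}$, and $m_\alpha=1$ for every $\alpha\in R_f\setminus\mathbb{Z}$ provided $\gcd(m_L,m_{L'})=1$ for all dense edges $L,L'$ of $D$ such that $L\subset L'$ or $L\cap L'$ is nondense.
   Context: $b_f(s)$ is the Bernstein–Sato polynomial: the monic polynomial of lowest degree with $b_f(s)f^s=Pf^{s+1}$ for some $P\in\mathcal{D}_X[s]$. An edge of $D$ is a nonempty intersection of some of the hyperplanes $D_i$ (a linear subspace; each $D_i$ itself is an edge). For an edge $L$, let $m_L$ be the number of $D_i$ containing $L$. A central arrangement in a vector space $W$ is decomposable if there is a nontrivial decomposition $W=W'\times W''$ such that the arrangement is the union of pull-backs of arrangements on $W'$ and on $W''$; otherwise indecomposable. An edge $L$ is dense if the arrangement formed by the hyperplanes $D_i\supset L$, viewed as an arrangement in $\mathbb{C}^n/L$, is indecomposable. $\mathcal{DE}(D)$ is the set of dense edges. For $\lambda\in\mathbb{C}$, $\mathcal{DE}(D,\lambda)=\{L\in\mathcal{DE}(D):\lambda^{m_L}=1\}$.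 Two elements $L,L'\in\mathcal{DE}(D,\lambda)$ are strongly adjacent if $L\subset L'$, or $L\supset L'$, or $L\cap L'$ is not a dense edge. $m(\lambda)$ is the maximal cardinality of a subset $S\subset\mathcal{DE}(D,\lambda)$ any two elements of which are strongly adjacent. *)

(* Defs.v *)
From HB Require Import structures.
From Stdlib Require Import Reals.
From mathcomp Require Import all_boot all_order all_algebra.
From mathcomp Require Import Rstruct complex mpoly.

Set Implicit Arguments.
Unset Strict Implicit.
Unset Printing Implicit Defensive.

Import Order.TTheory GRing.Theory Num.Theory.
Local Open Scope ring_scope.

Definition CC : Type := complex Rdefinitions.R.

Section Arrangement.
Variables (n k : nat).
(** A central arrangement of [k] hyperplanes in CC^n is given by [k] linear
    forms [a i : 'rV[CC]_n] (the form is x |-> \sum_j a i 0 j * x_j). *)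
Variable a : 'I_k -> 'rV[CC]_n.

Local Notation Rxs := {poly {mpoly CC[n]}}.

Definition lin_form (i : 'I_k) : {mpoly CC[n]} :=
  \sum_(j < n) (a i 0 j)%:MP * 'X_j.

Definition arr_poly : {mpoly CC[n]} := \prod_(i < k) lin_form i.

Definition reduced_arrangement : Prop :=
  (forall i, a i != 0) /\
  (forall i j : 'I_k, i != j -> forall c : CC, a i != c *: a j).

(** ** The module CC[x,s,f^-1] f^s.  An element is a pair (g, m) standing for
    g * f^(-m) * f^s, with g in CC[x][s]. *)
Definition fmod := (Rxs * nat)%type.

Definition Fp : Rxs := (arr_poly)%:P.

Definition fmod_eq (u v : fmod) : Prop :=
  u.1 * Fp ^+ v.2 = v.1 * Fp ^+ u.2.

Definition fmod_add (u v : fmod) : fmod :=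
  (u.1 * Fp ^+ v.2 + v.1 * Fp ^+ u.2, (u.2 + v.2)%N).

Definition fmod_scale (c : Rxs) (u : fmod) : fmod := (c * u.1, u.2).

(** action of d/dx_i:
    d_i (g f^(s-m)) = (d_i g * f + (s - m) g d_i f) f^(s-m-1) *)
Definition fmod_deriv (i : 'I_n) (u : fmod) : fmod :=
  (map_poly (mderiv i) u.1 * Fp
     + ('X - (u.2)%:R) * u.1 * (mderiv i arr_poly)%:P, u.2.+1).

(** An element of D_X[s] in normal form: a finite sum of terms c * d_{i1}...d_{ir},
    with c in CC[x][s].  (The d_i commute, so every operator has this form.) *)
Definition Dop := seq (Rxs * seq 'I_n).

Definition Dop_act (P : Dop) (u : fmod) : fmod :=
  foldr (fun t acc => fmod_add (fmod_scale t.1 (foldr fmod_deriv u t.2)) acc)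
        (0, 0%N) P.

Definition BS_functional_eq (b : {poly CC}) : Prop :=
  exists P : Dop,
    fmod_eq (map_poly (fun c => c%:MP) b, 0%N) (Dop_act P (Fp, 0%N)).

Definition is_BS_poly (b : {poly CC}) : Prop :=
  b \is monic /\ BS_functional_eq b /\
  (forall b' : {poly CC}, b' != 0 -> BS_functional_eq b' -> (size b <= size b')%N).

Definition neg_var (b : {poly CC}) : {poly CC} := b \Po (- 'X).

(** ** Edges: linear subspaces of CC^n (as row spaces of n x n matrices,
    normalised with <<_>> so that equal subspaces are equal matrices). *)
Definition hyperplane (i : 'I_k) : 'M[CC]_n := kermx (a i)^T.

Definition is_edge (L : 'M[CC]_n) : Prop :=
  exists S : {set 'I_k}, S != set0 /\ L = <<(\bigcap_(i in S) hyperplane i)>>%MS.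

Definition mult_edge (L : 'M[CC]_n) : nat :=
  #|[set i | (L <= hyperplane i)%MS]|.

(** The arrangement {D_i \supset L} in CC^n/L is decomposable: CC^n/L = W' x W''
    nontrivially; with P', P'' the preimages of W', W'' in CC^n
    (P' /\ P'' = L, P' + P'' = CC^n, L < P', L < P''), a hyperplane containing L
    is a pull-back from W' iff it contains P''. *)
Definition decomposable_at (L : 'M[CC]_n) : Prop :=
  exists P1 P2 : 'M[CC]_n,
    [/\ (P1 :&: P2 == L)%MS, (P1 + P2 == 1%:M)%MS, (L < P1)%MS, (L < P2)%MS &
        forall i, (L <= hyperplane i)%MS ->
          (P1 <= hyperplane i)%MS \/ (P2 <= hyperplane i)%MS].

Definition dense_edge (L : 'M[CC]_n) : Prop := is_edge L /\ ~ decomposable_at L.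

Definition dense_edge_lam (lam : CC) (L : 'M[CC]_n) : Prop :=
  dense_edge L /\ lam ^+ mult_edge L = 1.

Definition strongly_adjacent (L L' : 'M[CC]_n) : Prop :=
  (L <= L')%MS \/ (L' <= L)%MS \/ ~ dense_edge <<(L :&: L')>>%MS.

(** "N <= m(lambda)": there is a subset of DE(D,lambda) of cardinality >= N
    any two elements of which are strongly adjacent. *)
Definition m_lam_ge (lam : CC) (N : nat) : Prop :=
  exists s : seq 'M[CC]_n,
    [/\ uniq s, (N <= size s)%N,
        (forall L, L \in s -> dense_edge_lam lam L) &
        (forall L L', L \in s -> L' \in s -> L != L' -> strongly_adjacent L L')].

End Arrangement.

Definition lam_of (alpha : rat) : CC :=
  Complex (cos (2 * PI * ratr alpha)) (- sin (2 * PI * ratr alpha)).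

(* Main.v *)
(* The Bernstein-Sato polynomial divides any [b] satisfying a functional
   equation, so it suffices to construct a [b] with the required bound on
   multiplicities; no resolution of singularities is needed.  For a set [S] of
   hyperplanes let [f_S] be the product of its forms.  Induct on [S].
   - If the arrangement [S] splits as [S1 + S2] in complementary variables, use
     the product of the two polynomials; cliques of dense edges for [S1] and for
     [S2] unite, since an edge of [S1] meets an edge of [S2] in a split edge.
   - Otherwise the flat of [S] is a dense edge [L].  For each proper flat [T] of
     [S] the equation for [f_T] gives one for [f_S] up to a power of
     [f_S / f_T]; these quotients have no common zero outside [L].  So the least
     common multiple [b'] of the [b_T] makes the class of [b' f_S^s] modulo
     [D[s] f_S^(s+1)] killed by the [N]-th power of the ideal of [L].  The Euler field
     transverse to [L] acts on that class as [|S| s], hence it is killed by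
     [prod_(j < N) (|S| s + codim L + j)].  This adds at most one to the
     multiplicity of a root [x], and only if [|S| x] is an integer, in which case
     [L] can be added to every clique of edges containing it. *)
Require Import Defs.
From HB Require Import structures.
From Stdlib Require Import Reals Classical.
From mathcomp Require Import all_boot all_order all_algebra.
From mathcomp Require Import Rstruct complex mpoly ring zify.
Import Order.TTheory GRing.Theory Num.Theory.
Local Open Scope ring_scope.

Set Implicit Arguments.
Unset Strict Implicit.
Unset Printing Implicit Defensive.

(** * Modules generated by f^(s+1) *)

Definition derivation (R : comNzRingType) (d : R -> R) : Prop :=
  (forall x y, d (x + y) = d x + d y) /\
  (forall x y, d (x * y) = d x * y + x * d y).

Lemma derivation0 (R : comNzRingType) (d : R -> R) : derivation d -> d 0 = 0.
Proof. by case=> dD _; apply: (addrI (d 0)); rewrite -dD !addr0. Qed.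

Lemma derivation1 (R : comNzRingType) (d : R -> R) : derivation d -> d 1 = 0.
Proof.
case=> _ dM; apply: (addrI (d 1)); rewrite addr0.
by rewrite -[X in _ = X](congr1 d (mulr1 1)) dM mulr1 mul1r.
Qed.

Lemma derivation_nat (R : comNzRingType) (d : R -> R) (m : nat) :
  derivation d -> d m%:R = 0.
Proof.
move=> dd; elim: m => [|m IH]; first exact: derivation0.
by rewrite -addn1 natrD dd.1 IH derivation1 // addr0.
Qed.

Lemma derivation_expM (R : comNzRingType) (d : R -> R) (h : R) (m : nat) :
  derivation d -> d (h ^+ m) * h = m%:R * h ^+ m * d h.
Proof.
move=> dd; elim: m => [|m IH]; first by rewrite expr0 derivation1 // !mul0r.
rewrite exprS dd.2.
have -> : (d h * h ^+ m + h * d (h ^+ m)) * h =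
    d h * h ^+ m * h + h * (d (h ^+ m) * h) by ring.
by rewrite IH -addn1 natrD; ring.
Qed.

(* [tgen s f Ds g m] says that [g f^(-m) f^s] lies in the submodule generated
   by [f^(s+1)] under multiplications and the derivations in [Ds]. *)
Inductive tgen (R : comNzRingType) (s f : R) (Ds : (R -> R) -> Prop) :
    R -> nat -> Prop :=
| tgen_base : tgen s f Ds f 0
| tgen_add g h m :
    tgen s f Ds g m -> tgen s f Ds h m -> tgen s f Ds (g + h) m
| tgen_mul c g m : tgen s f Ds g m -> tgen s f Ds (c * g) m
| tgen_der d g m : Ds d -> tgen s f Ds g m ->
    tgen s f Ds (d g * f + (s - m%:R) * g * d f) m.+1
| tgen_down g m : tgen s f Ds (g * f) m.+1 -> tgen s f Ds g m
| tgen_up g m : tgen s f Ds g m -> tgen s f Ds (g * f) m.+1.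

Section Tgen.
Variables (R : comNzRingType) (s : R).
Implicit Types (f g h c : R) (Ds : (R -> R) -> Prop).

Lemma tgen0 f Ds m : tgen s f Ds 0 m.
Proof.
elim: m => [|m IH]; first by rewrite -(mul0r f); apply/tgen_mul/tgen_base.
by rewrite -(mul0r f); apply/tgen_up.
Qed.

Lemma tgen_sum f Ds m (I : Type) (r : seq I) (F : I -> R) :
  (forall i, tgen s f Ds (F i) m) -> tgen s f Ds (\sum_(i <- r) F i) m.
Proof.
move=> H; elim: r => [|i r IH]; first by rewrite big_nil; apply: tgen0.
by rewrite big_cons; apply: tgen_add.
Qed.

(** Passing from f^s to (f h)^s conjugates a derivation d by h^s, which adds s d(h)/h; one more
    factor [h] per differentiation clears this pole. *)
Lemma tgen_localize f h Ds g m :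
  (forall d, Ds d -> derivation d) -> tgen s f Ds g m ->
  exists N, tgen s (f * h) Ds (h ^+ (N + m) * g) m.
Proof.
move=> der; elim=> {g m}.
- by exists 1%N; rewrite addn0 expr1 mulrC; apply: tgen_base.
- move=> g g' m _ [N HN] _ [N' HN']; exists (N + N')%N.
  have -> : h ^+ (N + N' + m) * (g + g') =
    h ^+ N' * (h ^+ (N + m) * g) + h ^+ N * (h ^+ (N' + m) * g').
    by rewrite !exprD; ring.
  by apply: tgen_add; apply: tgen_mul.
- move=> c g m _ [N HN]; exists N.
  by rewrite mulrCA; apply: tgen_mul.
- move=> d g m Dd _ [N HN]; exists N.+1.
  have [dD dM] := der d Dd.
  have hd := derivation_expM h (N + m) (der d Dd).
  have H1 := tgen_mul h (tgen_der Dd HN).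
  (* On h^N g f^(-m) (f h)^s the derivation produces an unwanted term, (N + s) d(h)/h times the
     element; multiplied by [h] it becomes a polynomial multiple of the element and is
     subtracted. *)
  have H2 := tgen_mul (- (N%:R + s) * d h) (tgen_up HN).
  have := tgen_add H1 H2; congr (tgen _ _ _ _ _).
  rewrite !dM addSn addnS !exprS.
  have -> : h * ((d (h ^+ (N + m)) * g + h ^+ (N + m) * d g) * (f * h) +
     (s - m%:R) * (h ^+ (N + m) * g) * (d f * h + f * d h)) =
     (d (h ^+ (N + m)) * h) * g * f * h + h * (h ^+ (N + m) * d g * (f * h) +
     (s - m%:R) * (h ^+ (N + m) * g) * (d f * h + f * d h)) by ring.
  by rewrite hd natrD; ring.
- move=> g m _ [N HN]; exists N; apply: tgen_down.
  by move: HN; congr (tgen _ _ _ _ _); rewrite addnS exprS; ring.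
- move=> g m _ [N HN]; exists N.
  have := tgen_up HN.
  by congr (tgen _ _ _ _ _); rewrite addnS exprS; ring.
Qed.

(** Operators built from [Ds1] commute with [c] and with h^s, so what takes f^(s+1) to g f^(s-m)
    also takes c f (f h)^s to c g f^(-m) (f h)^s. The factor [h ^+ m] compensates the denominator (f
    h)^m. *)
Lemma tgen_transfer f h c Ds1 Ds g m :
  (forall d, Ds1 d -> [/\ Ds d, derivation d, d h = 0 & d c = 0]) ->
  tgen s (f * h) Ds (c * f) 0 -> tgen s f Ds1 g m ->
  tgen s (f * h) Ds (c * g * h ^+ m) m.
Proof.
move=> der base; elim=> {g m}.
- by rewrite expr0 mulr1.
- by move=> g g' m _ H _ H'; rewrite mulrDr mulrDl; apply: tgen_add.
- move=> e g m _ H; have := tgen_mul e H.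
  by congr (tgen _ _ _ _ _); ring.
- move=> d g m /der [Dd dd dh dc] _ /(tgen_der Dd).
  congr (tgen _ _ _ _ _).
  have hm : d (h ^+ m) = 0.
    elim: m => [|m IH]; first by rewrite expr0 derivation1.
    by rewrite exprS dd.2 dh IH mul0r mulr0 addr0.
  by rewrite !dd.2 dh dc hm exprS; ring.
- move=> g m _ H; apply: tgen_down.
  by move: H; congr (tgen _ _ _ _ _); rewrite exprS; ring.
- move=> g m _ /tgen_up; congr (tgen _ _ _ _ _); rewrite exprS; ring.
Qed.

Section Cone.
Variables (f : R) (Ds : (R -> R) -> Prop) (r deg : nat).
Variables (y : 'I_r -> R) (th : 'I_r -> R -> R).
Hypothesis th_in : forall j, Ds (th j).
Hypothesis th_der : forall j, derivation (th j).
Hypothesis th_s : forall j, th j s = 0.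
Hypothesis th_y : \sum_j th j (y j) = r%:R.
Hypothesis euler_y : forall k, \sum_j y j * th j (y k) = y k.
Hypothesis euler_f : \sum_j y j * th j f = deg%:R * f.

(** In the application the [y j] form a basis of the span of the linear forms and the [th j] are the
    dual directional derivatives, so this field is transverse to the flat. *)
Let euler g := \sum_j y j * th j g.

Let eulerM g h : euler (g * h) = euler g * h + g * euler h.
Proof.
rewrite /euler mulr_suml mulr_sumr -big_split; apply: eq_bigr => j _ /=.
by rewrite (th_der j).2; ring.
Qed.

(* On a class [g f^s] with [g] of degree [e] that all the [y j] kill,
   [0 = \sum_j th_j y_j = deg s + e + r]; each further power of the ideal of
   the [y j] costs one more factor. *)
Lemma tgen_cone (N e : nat) g :
  euler g = e%:R * g ->
  (forall w : seq 'I_r, size w = N -> tgen s f Ds ((\prod_(j <- w) y j) * g) 0) ->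
  tgen s f Ds ((\prod_(j < N) (deg%:R * s + (e + r + j)%:R)) * g) 0.
Proof.
elim: N e g => [|N IH] e g Eg killed.
  by have := killed [::] erefl; rewrite big_nil big_ord0.
rewrite big_ord_recl /= addn0.
pose q := \prod_(j < N) (deg%:R * s + (e.+1 + r + j)%:R).
have qE : \prod_(i < N) (deg%:R * s + (e + r + lift ord0 i)%:R) = q.
  by apply: eq_bigr => j _; rewrite /= /bump add1n addnS !addSn.
rewrite qE -mulrA; set w := q * g.
(* [y k * g] has degree [e.+1] and is killed by words one letter shorter; hence the shift by one in
   [q]. *)
have step k : tgen s f Ds (y k * w) 0.
  have -> : y k * w = q * (y k * g) by rewrite /w; ring.
  apply: IH.
    by rewrite eulerM Eg /euler euler_y -addn1 natrD; ring.
  move=> t szt; have := killed (k :: t); rewrite /= szt => /(_ erefl).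
  by rewrite big_cons; congr (tgen _ _ _ _ _); ring.
have th_q j : th j q = 0.
  rewrite /q; elim/big_rec: _ => [|i x _ IHx]; first exact: derivation1.
  rewrite (th_der j).2 IHx mulr0 addr0 (th_der j).1 (th_der j).2 th_s.
  by rewrite !derivation_nat //; ring.
have Ew : euler w = e%:R * w.
  rewrite /w eulerM Eg /euler big1 => [|j _]; last by rewrite th_q mulr0.
  by ring.
(* Differentiation raises the pole order by one, so the relation is proved with an extra factor [f],
   as the sum of the derivatives along [th j] of the elements [y j * w]. *)
apply: tgen_down.
have H : tgen s f Ds (\sum_j (th j (y j * w) * f + (s - 0%:R) * (y j * w) * th j f)) 1.
  by apply: tgen_sum => j; apply: tgen_der.
move: H; congr (tgen _ _ _ _ _).
rewrite (eq_bigr (fun j => th j (y j) * (w * f) + y j * th j w * f +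
    s * w * (y j * th j f))).
  rewrite !big_split /= -mulr_suml -mulr_suml -mulr_sumr th_y euler_f.
  by rewrite -/(euler w) Ew natrD; ring.
by move=> j _; rewrite (th_der j).2; ring.
Qed.

End Cone.
End Tgen.

(** * Ideals containing a power of an ideal generated by forms *)

Definition ideal_pred (R : comNzRingType) (J : R -> Prop) : Prop :=
  [/\ J 0, forall x y, J x -> J y -> J (x + y) & forall c x, J x -> J (c * x)].

Definition ideal_adjoin (R : comNzRingType) (J : R -> Prop) (x z : R) : Prop :=
  exists c, J (z - c * x).

Lemma ideal_adjoin_pred (R : comNzRingType) (J : R -> Prop) (x : R) :
  ideal_pred J -> ideal_pred (ideal_adjoin J x).
Proof.
case=> J0 JD JM; split.
- by exists 0; rewrite mul0r subr0.
- move=> u v [c Jc] [c' Jc']; exists (c + c').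
  by have := JD _ _ Jc Jc'; congr J; ring.
- move=> c u [e Je]; exists (c * e).
  by have := JM c _ Je; congr J; ring.
Qed.

Section IdealPower.
Variables (R : comNzRingType) (I : finType) (l : I -> R).

(** For an ideal [J]: the N-th power of the ideal generated by the [l i] with [i] in [S] is
    contained in [J]. *)
Definition power_in (S : {set I}) (J : R -> Prop) (N : nat) : Prop :=
  forall w : seq I, all (mem S) w -> size w = N -> J (\prod_(i <- w) l i).

(** The product of the ideals J + (l_i) lies in J + (prod l_i), so the exponents add up along [q]: a
    word is cut into an initial piece for the first letter of [q] and a rest for the others. *)
Lemma power_in_adjoin_seq (S : {set I}) (J : R -> Prop) (q : seq I) :
  ideal_pred J ->
  (forall i, i \in q -> exists N, power_in S (ideal_adjoin J (l i)) N) ->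
  exists N, power_in S (ideal_adjoin J (\prod_(i <- q) l i)) N.
Proof.
move=> idJ; have [J0 JD JM] := idJ; elim: q => [|i q IH] H.
  exists 0%N => w _ _; exists (\prod_(i <- w) l i).
  by rewrite big_nil mulr1 subrr.
have [N1 H1] := H i (mem_head _ _).
have [|N2 H2] := IH; first by move=> j jq; apply: H; rewrite inE jq orbT.
exists (N1 + N2)%N => w wS szw.
have [c Jc] : ideal_adjoin J (l i) (\prod_(i <- take N1 w) l i).
  apply: H1; last by rewrite size_take szw; case: ltnP; lia.
  by apply/allP => j /mem_take; apply/allP.
have [e Je] : ideal_adjoin J (\prod_(i <- q) l i) (\prod_(i <- drop N1 w) l i).
  apply: H2; last by rewrite size_drop szw; lia.
  by apply/allP => j /mem_drop; apply/allP.
exists (c * e); rewrite -(cat_take_drop N1 w) big_cat big_cons /=.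
set A := (\prod_(i <- take _ _) _) in Jc *.
set B := (\prod_(i <- drop _ _) _) in Je *.
by have := JD _ _ (JM B _ Jc) (JM (c * l i) _ Je); congr J; ring.
Qed.

Variables (S : {set I}) (cl : {set I} -> {set I}).
Hypothesis sub_cl : forall T : {set I}, T \subset cl T.
Hypothesis cl_ideal : forall (T : {set I}) (J : R -> Prop) (i : I),
  ideal_pred J -> (forall j, j \in T -> J (l j)) -> i \in cl T -> J (l i).

(* A prime ideal containing the powers below contains [l i] exactly for [i] in
   a closed set, which must then be everything; this is the corresponding
   statement for radicals, without primes. *)
Lemma ideal_power (J : R -> Prop) :
  ideal_pred J ->
  (forall T : {set I}, T \subset S -> ~~ (S \subset cl T) ->
     exists N, J ((\prod_(i in S :\: cl T) l i) ^+ N)) ->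
  exists N, power_in S J N.
Proof.
(* [T] collects forms already adjoined to [J]; the induction is on the number of forms of [S] still
   missing. *)
suff H m : forall (T : {set I}) (J : R -> Prop), (#|S :\: T| <= m)%N -> T \subset S ->
    ideal_pred J -> (forall j, j \in T -> J (l j)) ->
    (forall T' : {set I}, T' \subset S -> ~~ (S \subset cl T') ->
     exists N, J ((\prod_(i in S :\: cl T') l i) ^+ N)) ->
    exists N, power_in S J N.
  move=> idJ; apply: (H #|S :\: set0| set0 J) => //; first exact: sub0set.
  by move=> j; rewrite inE.
elim: m => [|m IH] T {}J cT TS idJ JT JN.
all: have [J0 JD JM] := idJ.
all: have [Scl|Scl] := boolP (S \subset cl T).
- exists 1%N => -[|i [|j w]] // /andP[iS _] _; rewrite big_seq1.
  exact: cl_ideal idJ JT (subsetP Scl _ iS).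
- have ST : S \subset T by rewrite -setD_eq0 -cards_eq0 -leqn0.
  by rewrite (subset_trans ST (sub_cl T)) in Scl.
- exists 1%N => -[|i [|j w]] // /andP[iS _] _; rewrite big_seq1.
  exact: cl_ideal idJ JT (subsetP Scl _ iS).
have [N HN] := JN T TS Scl.
(* The element of [J] given by the hypothesis is written as a word, each of whose letters lies
   outside [T], so that adjoining any one letter decreases the measure. *)
pose q := flatten (nseq N (enum (S :\: cl T))).
have qE : \prod_(i <- q) l i = (\prod_(i in S :\: cl T) l i) ^+ N.
  rewrite /q; elim: (N) => [|N' IHN] /=; first by rewrite big_nil expr0.
  by rewrite big_cat IHN exprS big_enum.
have [|M HM] := @power_in_adjoin_seq S J q idJ; last first.
  exists M => w wS szw; have [c] := HM w wS szw.
  rewrite qE => Jc.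
  rewrite -(subrK (c * (\prod_(i in S :\: cl T) l i) ^+ N) (\prod_(i <- w) l i)).
  by apply: JD => //; apply: JM.
move=> i /flattenP [x] /nseqP [-> _]; rewrite mem_enum inE => /andP[iT iS].
have iNT : i \notin T by apply: contra iT; apply: (subsetP (sub_cl T)).
apply: (IH (i |: T)).
- rewrite -ltnS; apply: leq_trans cT; apply: proper_card.
  apply/properP; split; first by apply: setDS; apply: subsetUr.
  by exists i; rewrite !inE ?iNT ?iS // eqxx.
- by rewrite subUset sub1set iS.
- exact: ideal_adjoin_pred.
- move=> j; rewrite !inE => /predU1P [->|jT].
    by exists 1; rewrite mul1r subrr.
  by exists 0; rewrite mul0r subr0; apply: JT.
- move=> T' T'S sT'; have [N' HN'] := JN T' T'S sT'.
  by exists N', 0; rewrite mul0r subr0.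
Qed.

End IdealPower.

(** * Functional equations of subarrangements *)

Section Directional.
Variables (F : numFieldType) (n : nat).
Local Notation K := {poly {mpoly F[n]}}.

Lemma map_mderiv_derivation (i : 'I_n) :
  derivation (map_poly (mderiv i) : K -> K).
Proof.
split=> x y; first exact: raddfD.
apply/polyP => j; rewrite coefD !coefM coef_map coefM raddf_sum -big_split.
by apply: eq_bigr => t _; rewrite /= mderivM !coef_map.
Qed.

Definition dir_deriv (v : 'rV[F]_n) (g : K) : K :=
  \sum_j (v 0 j)%:MP%:P * map_poly (mderiv j) g.

Definition lin_poly (w : 'rV[F]_n) : K := (\sum_j (w 0 j)%:MP * 'X_j)%:P.

Definition const_poly (b : {poly F}) : K := map_poly (@mpolyC n F) b.

Lemma dir_deriv_derivation v : derivation (dir_deriv v).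
Proof.
rewrite /dir_deriv; split=> x y.
  rewrite -big_split; apply: eq_bigr => j _.
  by rewrite (map_mderiv_derivation j).1 mulrDr.
rewrite mulr_suml mulr_sumr -big_split; apply: eq_bigr => j _ /=.
by rewrite (map_mderiv_derivation j).2 mulrDr; congr (_ + _); ring.
Qed.

Lemma dir_deriv_const_poly v b : dir_deriv v (const_poly b) = 0.
Proof.
rewrite /dir_deriv big1 // => j _.
have -> : map_poly (mderiv j) (const_poly b) = 0; last by rewrite mulr0.
by apply/polyP => t; rewrite !coef_map /= mderivC coef0.
Qed.

Lemma const_polyX : const_poly 'X = 'X.
Proof. exact: map_polyX. Qed.

Lemma dir_derivX v : dir_deriv v 'X = 0.
Proof. by rewrite -const_polyX dir_deriv_const_poly. Qed.

Lemma dir_deriv_lin_poly v w :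
  dir_deriv v (lin_poly w) = ((v *m w^T) 0 0)%:MP%:P.
Proof.
have dE j : map_poly (mderiv j) (lin_poly w) = (w 0 j)%:MP%:P.
  rewrite /lin_poly map_polyC /= (raddf_sum (mderiv j)) /= (bigD1 j) //= big1 => [|t tj].
    rewrite addr0 mderiv_mulC mderivX mnmE eqxx.
    have -> : (U_(j) - U_(j) = 0)%MM by apply/mnmP => t; rewrite !mnmE subnn.
    by rewrite mpolyX0 scale1r mulr1.
  by rewrite mderiv_mulC mderivX mnmE (negbTE tj) scale0r mulr0.
rewrite /dir_deriv mxE (raddf_sum (@mpolyC n F)) (raddf_sum polyC).
by apply: eq_bigr => j _; rewrite dE mxE /= mpolyCM polyCM.
Qed.

Lemma lin_polyZ c w : lin_poly (c *: w) = c%:MP%:P * lin_poly w.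
Proof.
rewrite /lin_poly -rmorphM; congr (_ %:P); rewrite mulr_sumr.
by apply: eq_bigr => j _; rewrite mxE rmorphM mulrA.
Qed.

Lemma lin_poly_sum (I : Type) (r : seq I) (P : pred I) (u : I -> 'rV[F]_n) :
  lin_poly (\sum_(i <- r | P i) u i) = \sum_(i <- r | P i) lin_poly (u i).
Proof.
apply: (big_morph lin_poly); rewrite /lin_poly; last first.
  by rewrite big1 // => j _; rewrite mxE rmorph0 mul0r.
move=> x w; rewrite -raddfD -big_split; congr (_ %:P).
by apply: eq_bigr => j _; rewrite mxE raddfD mulrDl.
Qed.

Lemma lin_poly_mul m (c : 'rV[F]_m) (M : 'M[F]_(m, n)) :
  lin_poly (c *m M) = \sum_j (c 0 j)%:MP%:P * lin_poly (row j M).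
Proof. by rewrite mulmx_sum_row lin_poly_sum; apply: eq_bigr => j _; rewrite lin_polyZ. Qed.

End Directional.

Section FlatAlgebra.
Variables (F : numFieldType) (n k : nat) (a : 'I_k -> 'rV[F]_n).
Local Notation K := {poly {mpoly F[n]}}.
Implicit Types (S T : {set 'I_k}) (M P : 'M[F]_n).

Definition sub_poly S : K := \prod_(i in S) lin_poly (a i).

Definition dirs_along (p : 'M[F]_n) (d : K -> K) : Prop :=
  exists v, d = dir_deriv (v *m p).

(* The induction keeps track of the directions of differentiation, so that for
   an arrangement that splits the two functional equations involve commuting
   operators. *)
Definition BS_sub S (p : 'M[F]_n) (b : {poly F}) : Prop :=
  tgen 'X (sub_poly S) (dirs_along p) (const_poly n b) 0.

(** [v *m p] and [v] then differ by a vector of the flat of [S], so directions along [p] take all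
    the values on the forms of [S] that arbitrary directions take. *)
Definition fixes_forms (p : 'M[F]_n) S : Prop :=
  forall i, i \in S -> p *m (a i)^T = (a i)^T.

Definition hyp (i : 'I_k) : 'M[F]_n := kermx (a i)^T.

Definition flat S : 'M[F]_n := <<\bigcap_(i in S) hyp i>>%MS.

Definition flat_closure S : {set 'I_k} :=
  [set i | (flat S <= hyp i)%MS].

Lemma sub_hyp m (M : 'M[F]_(m, n)) i :
  (M <= hyp i)%MS <-> M *m (a i)^T = 0.
Proof. by rewrite /hyp; split=> H; apply/sub_kermxP. Qed.

Lemma sub_flatP m (M : 'M[F]_(m, n)) S :
  reflect (forall i, i \in S -> (M <= hyp i)%MS) (M <= flat S)%MS.
Proof. by rewrite genmxE; apply: sub_bigcapmxP. Qed.

Lemma flat_set0 : flat set0 = 1%:M.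
Proof. by rewrite /flat big_set0 genmx1. Qed.

Lemma flat_sub_hyp S i : i \in S -> (flat S <= hyp i)%MS.
Proof. by move=> iS; rewrite genmxE; apply: (bigcapmx_inf i). Qed.

Lemma sub_flat_closure S : S \subset flat_closure S.
Proof. by apply/subsetP => i iS; rewrite inE flat_sub_hyp. Qed.

Lemma dirs_along_derivation p d : dirs_along p d -> derivation d.
Proof. by case=> v ->; apply: dir_deriv_derivation. Qed.

Lemma dir_deriv_sub_poly0 v S :
  (forall i, i \in S -> v *m (a i)^T = 0) -> dir_deriv v (sub_poly S) = 0.
Proof.
move=> H; rewrite /sub_poly; elim/big_rec: _ => [|i x iS IH].
  exact/derivation1/dir_deriv_derivation.
rewrite (dir_deriv_derivation v).2 IH mulr0 addr0 dir_deriv_lin_poly H //.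
by rewrite mxE !raddf0 mul0r.
Qed.

Lemma sub_polyU S1 S2 : [disjoint S1 & S2] ->
  sub_poly (S1 :|: S2) = sub_poly S1 * sub_poly S2.
Proof. by move=> dis; rewrite /sub_poly -bigU //; apply: eq_bigl => i; rewrite !inE. Qed.

Definition forms S : 'M[F]_(k, n) := \matrix_j (if j \in S then a j else 0).

Lemma form_sub_forms S i : i \in S -> (a i <= forms S)%MS.
Proof. by move=> iS; have := row_sub i (forms S); rewrite rowK iS. Qed.

(** Double annihilator: the columns of [cokermx (forms S)] lie in the flat of [S], so [a i] vanishes
    on them. *)
Lemma form_closure S i : i \in flat_closure S -> (a i <= forms S)%MS.
Proof.
rewrite inE => /sub_hyp H; rewrite submxE.
have K1 : ((cokermx (forms S))^T <= flat S)%MS.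
  apply/sub_flatP => j jS; apply/sub_hyp.
  rewrite -trmx_mul; apply: (canLR (@trmxK _ _ _)); rewrite trmx0.
  by apply/eqP; rewrite -submxE form_sub_forms.
have /submxP [X XE] := K1.
apply/eqP; apply: (can_inj (@trmxK _ _ _)).
by rewrite trmx_mul XE -mulmxA H mulmx0 trmx0.
Qed.

Lemma lin_poly_ideal (J : K -> Prop) S w :
  ideal_pred J -> (forall j, j \in S -> J (lin_poly (a j))) ->
  (w <= forms S)%MS -> J (lin_poly w).
Proof.
case=> J0 JD JM JS /submxP [c ->]; rewrite lin_poly_mul.
elim/big_ind: _ => // j _; apply: JM; rewrite rowK; case: ifP => [/JS //|_].
by have := lin_polyZ 0 (0 : 'rV[F]_n); rewrite scale0r !raddf0 mul0r => ->.
Qed.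

Lemma BS_sub_set0 p : BS_sub set0 p 1.
Proof.
have := tgen_base 'X (sub_poly set0) (dirs_along p).
by rewrite /BS_sub /sub_poly big_set0 /const_poly rmorph1.
Qed.

Lemma BS_sub_mull S p b c : BS_sub S p b -> BS_sub S p (c * b).
Proof. by move=> H; rewrite /BS_sub /const_poly rmorphM; apply/tgen_mul/H. Qed.

(** Each factor gets directions that annihilate the forms of the other. The operator for [S1] takes
    the full product to [b1] times the product of [S2], and the operator for [S2] then takes this to
    [b1 * b2]. *)
Lemma BS_sub_split S1 S2 P1 P2 p :
  [disjoint S1 & S2] -> (P1 + P2 == 1%:M)%MS ->
  (forall i, i \in S1 -> (P1 <= hyp i)%MS) ->
  (forall i, i \in S2 -> (P2 <= hyp i)%MS) ->
  fixes_forms p (S1 :|: S2) ->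
  exists p1 p2, [/\ fixes_forms p1 S1, fixes_forms p2 S2 &
    forall b1 b2, BS_sub S1 p1 b1 -> BS_sub S2 p2 b2 ->
      BS_sub (S1 :|: S2) p (b1 * b2)].
Proof.
move=> dis /andP[_ /sub_addsmxP [[u1 u2] /= uE]] H1 H2 pS.
have E1 i : i \in S1 -> u1 *m P1 *m (a i)^T = 0.
  by move=> /H1 /sub_hyp PE; rewrite -mulmxA PE mulmx0.
have E2 i : i \in S2 -> u2 *m P2 *m (a i)^T = 0.
  by move=> /H2 /sub_hyp PE; rewrite -mulmxA PE mulmx0.
have F1 i : i \in S1 -> u2 *m P2 *m (a i)^T = (a i)^T.
  by move=> iS; rewrite -[RHS]mul1mx uE mulmxDl E1 // add0r.
have F2 i : i \in S2 -> u1 *m P1 *m (a i)^T = (a i)^T.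
  by move=> iS; rewrite -[RHS]mul1mx uE mulmxDl E2 // addr0.
have pS1 : fixes_forms p S1.
  by move=> i iS; apply: pS; rewrite inE iS.
have pS2 : fixes_forms p S2.
  by move=> i iS; apply: pS; rewrite inE iS orbT.
have along (q : 'M[F]_n) d : dirs_along (q *m p) d -> dirs_along p d.
  by case=> v ->; exists (v *m q); rewrite mulmxA.
have dir0 (q : 'M[F]_n) S d c : fixes_forms p S ->
    (forall i, i \in S -> q *m (a i)^T = 0) -> dirs_along (q *m p) d ->
    [/\ dirs_along p d, derivation d, d (sub_poly S) = 0 & d (const_poly n c) = 0].
  move=> pS' qS Dd; split; [exact: along Dd|exact: dirs_along_derivation Dd|..].
    case: Dd => v ->; apply: dir_deriv_sub_poly0 => i iS.
    by rewrite -!mulmxA pS' // qS // mulmx0.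
  by case: Dd => v ->; apply: dir_deriv_const_poly.
(* The indices cross: [P2] lies in the hyperplanes of [S2], so [u2 *m P2] kills the forms of [S2]
   and fixes those of [S1]. *)
exists (u2 *m P2 *m p), (u1 *m P1 *m p); split.
- by move=> i iS; rewrite -[_ *m p *m _]mulmxA pS1 // F1.
- by move=> i iS; rewrite -[_ *m p *m _]mulmxA pS2 // F2.
move=> b1 b2 G1 G2.
have step1 : tgen 'X (sub_poly S1 * sub_poly S2) (dirs_along p)
    (const_poly n b1 * sub_poly S2) 0.
  rewrite [const_poly n b1 * _]mulrC -[_ * const_poly n b1]mulr1.
  rewrite -(expr0 (sub_poly S2)); apply: tgen_transfer G1.
    by move=> d /(dir0 _ _ _ 0 pS2 E2) [].
  by rewrite [sub_poly S2 * _]mulrC; apply: tgen_base.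
rewrite /BS_sub sub_polyU // /const_poly rmorphM /= -/(const_poly n b1) -/(const_poly n b2).
rewrite [sub_poly S1 * _]mulrC -[_ * const_poly n b2]mulr1.
rewrite -(expr0 (sub_poly S1)); apply: tgen_transfer G2.
  by move=> d /(dir0 _ _ _ b1 pS1 E1) [].
by rewrite [sub_poly S2 * _]mulrC.
Qed.

End FlatAlgebra.

(** Expand the first letter of the word in the [l i], then apply induction to the colon ideal (J : l
    i). *)
Lemma power_in_span (R : comNzRingType) (I I' : finType) (l : I -> R)
    (S : {set I}) (y : I' -> R) (c : I' -> I -> R) (J : R -> Prop) (N : nat) :
  (forall j, y j = \sum_(i in S) c j i * l i) ->
  ideal_pred J -> power_in l S J N ->
  forall w : seq I', size w = N -> J (\prod_(j <- w) y j).
Proof.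
move=> yE; elim: N J => [|N IH] J idJ JN [|j w] //= szw.
  by have := JN [::] erefl erefl; rewrite !big_nil.
have [J0 JD JM] := idJ.
rewrite big_cons yE mulr_suml; apply: (big_ind J) => // i iS.
rewrite -mulrA; apply: (JM (c j i)).
pose Ji z := J (l i * z).
apply: (IH Ji) => //; last by case: szw.
  split; rewrite /Ji.
  - by rewrite mulr0.
  - by move=> u v Ju Jv; rewrite mulrDr; apply: JD.
  - by move=> e u Ju; rewrite mulrCA; apply: JM.
move=> t tS szt; have := JN (i :: t); rewrite /= iS tS szt => /(_ erefl erefl).
by rewrite big_cons.
Qed.

(** * From the proper flats to the whole arrangement by the Euler field *)

Section Cone.
Variables (F : numFieldType) (n k : nat) (a : 'I_k -> 'rV[F]_n).
Local Notation K := {poly {mpoly F[n]}}.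
Implicit Types (S T : {set 'I_k}).

Lemma fixes_forms_mul p S : fixes_forms a p S ->
  p *m (forms a S)^T = (forms a S)^T.
Proof.
move=> pS; apply: (can_inj (@trmxK _ _ _)); rewrite trmx_mul trmxK.
apply/row_matrixP => i; rewrite row_mul rowK; case: ifP => iS; last by rewrite mul0mx.
by apply: (can_inj (@trmxK _ _ _)); rewrite trmx_mul trmxK pS.
Qed.

Lemma euler_prod (E : K -> K) (S : {set 'I_k}) : derivation E ->
  (forall i, i \in S -> E (lin_poly (a i)) = lin_poly (a i)) ->
  E (sub_poly a S) = #|S|%:R * sub_poly a S.
Proof.
move=> dE El; rewrite /sub_poly -sum1_card natr_sum.
pose P (x c : K) := E x = c * x.
have : P (\prod_(i in S) lin_poly (a i)) (\sum_(i in S) 1).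
  apply: big_rec2 => [|i x c iS]; rewrite /P.
    by rewrite mul0r derivation1.
  by move=> IH; rewrite dE.2 El // IH; ring.
by [].
Qed.

(** Here [N] is a power of the ideal of the flat that kills the class of [b] f_S^s, and [r] is the
    codimension of the flat. *)
Lemma BS_sub_cone S p b : fixes_forms a p S ->
  (forall T, T \subset S -> ~~ (S \subset flat_closure a T) ->
     BS_sub a (S :&: flat_closure a T) p b) ->
  exists N r : nat,
    BS_sub a S p ((\prod_(j < N) (#|S|%:R *: 'X + (r + j)%:R%:P)) * b).
Proof.
move=> pS HT.
(* The annihilator of the class of [b] f_S^s modulo the module generated by f_S^(s+1). *)
pose J (g : K) := tgen 'X (sub_poly a S) (dirs_along p) (g * const_poly n b) 0.
have idJ : ideal_pred J.
  split; rewrite /J.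
  - by rewrite mul0r; apply: tgen0.
  - by move=> x y Jx Jy; rewrite mulrDl; apply: tgen_add.
  - by move=> c x Jx; rewrite -mulrA; apply: tgen_mul.
have [|N JN] := @ideal_power _ _ (fun i => lin_poly (a i)) S (flat_closure a)
    (sub_flat_closure a)
    (fun T J' i idJ' JT' iT => lin_poly_ideal idJ' JT' (form_closure iT)) J idJ.
  move=> T TS /(HT T TS) HB.
  have [N HN] := tgen_localize (sub_poly a (S :\: flat_closure a T))
    (@dirs_along_derivation _ _ p) HB.
  exists N; rewrite /J; move: HN; rewrite addn0 -sub_polyU ?setID //.
  rewrite -setI_eq0; apply/eqP/setP => i; move: (flat_closure a T) => C.
  by rewrite !inE; case: (i \in C); rewrite ?andbF ?andbT.
(* The rows of [Y] are a basis of the span of the forms and the columns of [Q] are dual vectors;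
   multiplying these by [p] makes them admissible directions without changing their values on the
   forms. *)
have [r [Y [Q [YQ YS SY]]]] : exists r (Y : 'M[F]_(r, n)) (Q : 'M_(n, r)),
    [/\ Y *m Q = 1%:M, (Y <= forms a S)%MS & (forms a S <= Y)%MS].
  exists (\rank (forms a S)), (row_base (forms a S)), (pinvmx (row_base (forms a S))).
  by split; rewrite ?eq_row_base // mulmxVp // row_base_free.
pose y (j : 'I_r) : K := lin_poly (row j Y).
pose th (j : 'I_r) : K -> K := dir_deriv (row j Q^T *m p).
have pY : p *m Y^T = Y^T.
  by have /submxP [X ->] := YS; rewrite trmx_mul mulmxA fixes_forms_mul.
have th_der j : derivation (th j) by apply: dir_deriv_derivation.
have th_lin j (c : 'rV_r) : th j (lin_poly (c *m Y)) = (c 0 j)%:MP%:P.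
  rewrite /th dir_deriv_lin_poly trmx_mul mulmxA -[_ *m p *m _]mulmxA pY.
  by rewrite -!row_mul -trmx_mul YQ trmx1 mul1mx !mxE.
have rowY j : row j Y = delta_mx 0 j *m Y by rewrite rowE.
have euler_lin w : (w <= Y)%MS -> \sum_j y j * th j (lin_poly w) = lin_poly w.
  move=> /submxP [c ->]; rewrite [RHS]lin_poly_mul; apply: eq_bigr => j _.
  by rewrite th_lin mulrC.
have eulerD : derivation (fun g => \sum_j y j * th j g).
  split=> u v.
    by rewrite -big_split; apply: eq_bigr => j _; rewrite (th_der j).1 mulrDr.
  rewrite mulr_suml mulr_sumr -big_split; apply: eq_bigr => j _ /=.
  by rewrite (th_der j).2; ring.
exists N, r; rewrite /BS_sub /const_poly rmorphM /= -/(const_poly n b).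
have -> : map_poly (@mpolyC n F) (\prod_(j < N) (#|S|%:R *: 'X + (r + j)%:R%:P)) =
    \prod_(j < N) (#|S|%:R * 'X + (0 + r + j)%:R).
  rewrite rmorph_prod; apply: eq_bigr => j _.
  rewrite -mul_polyC rmorphD rmorphM /= map_polyX !map_polyC /= add0n.
  by rewrite !rmorph_nat.
apply: (@tgen_cone _ 'X _ _ r #|S| y th) => //.
- by move=> j; exists (row j Q^T).
- by move=> j; apply: dir_derivX.
- rewrite (eq_bigr (fun=> 1)) ?sumr_const ?card_ord // => j _.
  by rewrite /y rowY th_lin mxE !eqxx !rmorph1.
- by move=> j; apply/euler_lin/row_sub.
- apply: euler_prod eulerD _ => i iS; apply: euler_lin.
  by apply: submx_trans SY; apply: form_sub_forms.
- rewrite mul0r big1 // => j _.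
  by rewrite /th dir_deriv_const_poly mulr0.
move=> w szw; apply: (@power_in_span _ _ _ (fun i => lin_poly (a i)) S y
  (fun j i => ((row j Y *m pinvmx (forms a S)) 0 i)%:MP%:P) J N) => // j.
have /mulmxKpV yE : (row j Y <= forms a S)%MS by apply: submx_trans YS; apply: row_sub.
rewrite /y -{1}yE lin_poly_mul [RHS]big_mkcond; apply: eq_bigr => i _.
rewrite rowK; case: ifP => // _.
by have := lin_polyZ 0 (0 : 'rV[F]_n); rewrite scale0r !raddf0 mul0r => ->; rewrite mulr0.
Qed.

End Cone.

(** * Multiplicities of roots *)

Section RootMultiplicity.
Variable F : numFieldType.
Implicit Types (b c : {poly F}) (x : F).

(** In the least common multiple [c1 * c2 * g] the cofactors are coprime, so at most one of them
    vanishes at [x]. *)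
Lemma lcm_mup b1 b2 : b1 != 0 -> b2 != 0 ->
  exists c, [/\ c != 0, b1 %| c, b2 %| c &
    forall x, (mup x c <= maxn (mup x b1) (mup x b2))%N].
Proof.
move=> nz1 nz2; set g := gcdp b1 b2.
have gnz : g != 0 by rewrite gcdp_eq0 negb_and nz1.
have E1 : b1 = b1 %/ g * g by rewrite divpK // dvdp_gcdl.
have E2 : b2 = b2 %/ g * g by rewrite divpK // dvdp_gcdr.
set c1 := b1 %/ g in E1; set c2 := b2 %/ g in E2.
have cop : coprimep c1 c2 by apply: coprimep_div_gcd; rewrite nz1.
have c1nz : c1 != 0 by apply: contraNneq nz1 => c0; rewrite E1 c0 mul0r.
have c2nz : c2 != 0 by apply: contraNneq nz2 => c0; rewrite E2 c0 mul0r.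
exists (c1 * c2 * g); split.
- by rewrite !mulf_neq0.
- by rewrite {1}E1 mulrAC dvdp_mulr.
- by rewrite {1}E2 -mulrA dvdp_mull.
move=> x; rewrite E1 E2 !mupM ?mulf_neq0 //.
have [/(coprimep_root cop) r2|r1] := boolP (root c1 x).
  by rewrite (mupNroot r2) addn0 leq_maxl.
by rewrite (mupNroot r1) leq_maxr.
Qed.

(** [Q] records which index accounts for the multiplicity at [x]: the clique for [x] will be taken
    from that flat. *)
Lemma lcm_mup_seq (I : eqType) (s : seq I) (Q : I -> {poly F} -> Prop) :
  (forall t, t \in s -> exists b, b != 0 /\ Q t b) ->
  exists c, [/\ c != 0, forall t, t \in s -> exists b, Q t b /\ b %| c &
    forall x, (0 < mup x c)%N ->
      exists t b, [/\ t \in s, Q t b & (mup x c <= mup x b)%N]].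
Proof.
elim: s => [|t s IH] H.
  by exists 1; split=> [|//|x]; rewrite ?oner_neq0 // mupNroot ?root1.
have [|c [cnz Hc mc]] := IH; first by move=> u us; apply: H; rewrite inE us orbT.
have [b [bnz Qb]] := H t (mem_head _ _).
have [e [enz be ce me]] := lcm_mup bnz cnz; exists e; split=> //.
  move=> u; rewrite inE => /predU1P [->|/Hc [b' [Qb' b'c]]]; first by exists b.
  by exists b'; split=> //; apply: dvdp_trans ce.
move=> x epos; have := me x; rewrite leq_max => /orP [le|le].
  by exists t, b; rewrite mem_head.
have [u [b' [us Qb' le']]] := mc x (leq_trans epos le).
by exists u, b'; rewrite inE us orbT; split=> //; apply: leq_trans le'.
Qed.

Lemma mup_arithmetic_prod (d r N : nat) x : (0 < d)%N ->
  let q := \prod_(j < N) (d%:R *: 'X + (r + j)%:R%:P : {poly F}) in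
  [/\ q != 0, (mup x q <= 1)%N &
      (0 < mup x q)%N -> exists z : int, x * d%:R = z%:~R].
Proof.
move=> d0 q; have dnz : d%:R != 0 :> F by rewrite pnatr_eq0 -lt0n.
have root_fac m : root (d%:R *: 'X + m%:R%:P) x = (x * d%:R == - m%:R).
  by rewrite /root !hornerE mulrC addr_eq0.
have fac_nz m : d%:R *: 'X + m%:R%:P != 0 :> {poly F}.
  apply: contraNneq dnz => /(congr1 (fun p : {poly F} => p`_1)).
  by rewrite coefD coefZ coefX coefC mulr1 addr0 coef0 => ->.
have qnz : q != 0 by apply/prodf_neq0 => j _.
have fac_le m : (mup x (d%:R *: 'X + m%:R%:P) <= 1)%N.
  rewrite mup_leq //; apply/negP => /dvdp_leq; rewrite fac_nz => /(_ isT).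
  rewrite size_exp_XsubC => /leq_trans /(_ (size_polyD _ _)).
  rewrite leq_max => /orP [/leq_trans /(_ (size_scale_leq _ _))|/leq_trans].
    by rewrite size_polyX.
  by move=> /(_ _ (size_polyC_leq1 _)).
split=> //.
  rewrite /q; elim: (N) => [|m IH]; first by rewrite big_ord0 mupNroot ?root1.
  rewrite big_ord_recr /= mupM //; last by apply/prodf_neq0 => j _.
  have [rt|nrt] := boolP (root (d%:R *: 'X + (r + m)%:R%:P) x); last first.
    by rewrite (mupNroot nrt) addn0.
  rewrite mupNroot ?add0n // /root horner_prod; apply/prodf_neq0 => j _.
  change (~~ root (d%:R *: 'X + (r + j)%:R%:P) x); rewrite root_fac.
  move: rt; rewrite root_fac => /eqP ->; rewrite eqr_opp eqr_nat eqn_add2l.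
  by rewrite gtn_eqF // ltn_ord.
move=> mpos; have : root q x by apply: contraLR mpos => /mupNroot ->.
rewrite /root horner_prod => /prodf_eq0 [j _ H].
exists (- (r + j)%:Z); apply/eqP; rewrite rmorphN /=.
by rewrite -root_fac.
Qed.

End RootMultiplicity.

(** * Dense edges *)

Section DenseFlats.
Variables (F : numFieldType) (n k : nat) (a : 'I_k -> 'rV[F]_n).
Hypothesis a_neq0 : forall i, a i != 0.
Local Notation hyp := (hyp a).
Local Notation flat := (flat a).
Local Notation flat_closure := (flat_closure a).
Implicit Types (S T : {set 'I_k}) (L P : 'M[F]_n) (x : F).

Definition mult_at L : nat := #|[set i | (L <= hyp i)%MS]|.

Definition splits_by L P1 P2 : Prop :=
  [/\ (P1 :&: P2 == L)%MS, (P1 + P2 == 1%:M)%MS, (L < P1)%MS, (L < P2)%MS &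
      forall i, (L <= hyp i)%MS -> (P1 <= hyp i)%MS \/ (P2 <= hyp i)%MS].

Definition dense L : Prop :=
  (exists S, S != set0 /\ L = flat S) /\ ~ exists P1 P2, splits_by L P1 P2.

Definition adjacent L L' : Prop :=
  (L <= L')%MS \/ (L' <= L)%MS \/ ~ dense <<(L :&: L')>>%MS.

(** Integrality of x m_L stands for lambda^(m_L) = 1 and makes sense over any [F]. The bound [L0]
    confines the clique to the subarrangement through [L0]. *)
Definition dense_clique (L0 : 'M[F]_n) x (s : seq 'M[F]_n) : Prop :=
  [/\ uniq s,
      forall L, L \in s -> [/\ dense L, (L0 <= L)%MS &
        exists z : int, x * (mult_at L)%:R = z%:~R] &
      forall L L', L \in s -> L' \in s -> L != L' -> adjacent L L'].

Definition closed_flat S : Prop := flat_closure S \subset S.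

Lemma flatS S T : S \subset T -> (flat T <= flat S)%MS.
Proof. by move=> /subsetP ST; apply/sub_flatP => i /ST; apply: flat_sub_hyp. Qed.

Lemma flat_closureP S i : reflect (flat S <= hyp i)%MS (i \in flat_closure S).
Proof. by rewrite inE; apply: idP. Qed.

Lemma full_not_sub_hyp m (M : 'M[F]_(m, n)) i :
  (1%:M <= M)%MS -> ~~ (M <= hyp i)%MS.
Proof.
move=> M1; apply/negP => /(submx_trans M1) /sub_hyp; rewrite mul1mx => a0.
by move: (a_neq0 i); rewrite -[a i]trmxK a0 trmx0 eqxx.
Qed.

Lemma dense_not_full L : dense L -> ~~ (1%:M <= L)%MS.
Proof.
case=> [[S [/set0Pn [i iS] ->]] _]; apply/negP => /(full_not_sub_hyp i) /negP.
by case; apply: flat_sub_hyp.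
Qed.

Lemma mult_at_flat S : closed_flat S -> mult_at (flat S) = #|S|.
Proof.
move=> clS; apply: eq_card; apply/subset_eqP; rewrite clS /=.
exact: sub_flat_closure.
Qed.

Lemma dense_cliqueW L0 L1 x s :
  (L1 <= L0)%MS -> dense_clique L0 x s -> dense_clique L1 x s.
Proof.
move=> le [us sP adj]; split=> // L /sP [dL L0L zL]; split=> //.
exact: submx_trans L0L.
Qed.

Lemma dense_clique_cons L0 L1 x s : dense L0 -> (L0 <= L1)%MS ->
  ~~ (L1 <= L0)%MS -> (exists z : int, x * (mult_at L0)%:R = z%:~R) ->
  dense_clique L1 x s -> dense_clique L0 x (L0 :: s).
Proof.
move=> dL0 le nle z0 /[dup] cl1 /(dense_cliqueW le) [us sP adj].
have [_ sP1 _] := cl1.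
split=> [|L|L L'] /=.
- by rewrite us andbT; apply: contra nle => /sP1 [].
- by rewrite inE => /predU1P [->|/sP].
rewrite !inE => /predU1P [->|Ls] /predU1P [->|L's].
- by rewrite eqxx.
- by move=> _; left; have [] := sP _ L's.
- by move=> _; right; left; have [] := sP _ Ls.
- exact: adj.
Qed.

(** The pair [L], [L'] itself splits the intersection. A hyperplane through it contains [L0], hence
    say [P1]; by the modular law L = P1 + (P2 :&: L), so it contains [L]. *)
Lemma not_dense_cap L0 P1 P2 L L' : splits_by L0 P1 P2 ->
  dense L -> dense L' -> (P1 <= L)%MS -> (P2 <= L')%MS ->
  ~ dense <<(L :&: L')>>%MS.
Proof.
case=> /eqmxP capP /eqmxP sumP _ _ split dL dL' PL PL' [_ []].
have sumL (A B : 'M[F]_n) : (P1 <= A)%MS -> (P2 <= B)%MS -> (1%:M <= A + B)%MS.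
  by move=> PA PB; rewrite -sumP; apply: addsmxS.
exists L, L'; split.
- by apply/eqmxP/eqmx_sym/genmxE.
- by rewrite submx1 sumL.
- rewrite ltmxE genmxE capmxSl /=; apply/negP; rewrite genmxE sub_capmx.
  move=> /andP[_ LL']; case/negP: (dense_not_full dL').
  by apply: submx_trans (sumL _ _ PL PL') _; rewrite addsmx_sub LL' submx_refl.
- rewrite ltmxE genmxE capmxSr /=; apply/negP; rewrite genmxE sub_capmx.
  move=> /andP[L'L _]; case/negP: (dense_not_full dL).
  by apply: submx_trans (sumL _ _ PL PL') _; rewrite addsmx_sub L'L submx_refl.
move=> i; rewrite genmxE => Mi.
have {split}[|P1i|P2i] := split i.
- apply: submx_trans Mi; rewrite -capP.
  by rewrite sub_capmx (submx_trans (capmxSl _ _) PL) (submx_trans (capmxSr _ _) PL').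
- left; have : (L <= P1 + (P2 :&: L))%MS.
    by rewrite (matrix_modl _ PL) sub_capmx submx_refl andbT sumP submx1.
  move/submx_trans; apply; rewrite addsmx_sub P1i /=; apply: submx_trans Mi.
  by rewrite sub_capmx capmxSr (submx_trans (capmxSl _ _)).
- right; have : (L' <= P2 + (P1 :&: L'))%MS.
    by rewrite (matrix_modl _ PL') sub_capmx submx_refl andbT addsmxC sumP submx1.
  move/submx_trans; apply; rewrite addsmx_sub P2i /=; apply: submx_trans Mi.
  by rewrite sub_capmx capmxSr (submx_trans (capmxSl _ _)).
Qed.

Lemma dense_clique_cat L0 P1 P2 x s1 s2 : splits_by L0 P1 P2 ->
  dense_clique P1 x s1 -> dense_clique P2 x s2 -> dense_clique L0 x (s1 ++ s2).
Proof.
move=> spl [u1 sP1 adj1] [u2 sP2 adj2].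
have [_ /eqmxP sumP lt1 lt2 _] := spl.
split=> [|L|L L'].
- rewrite cat_uniq u1 u2 andbT /=; apply/hasPn => L /sP2 [dL P2L _].
  apply/negP => /sP1 [_ P1L _]; case/negP: (dense_not_full dL).
  by rewrite -sumP addsmx_sub P1L P2L.
- rewrite mem_cat => /orP [/sP1|/sP2] [dL PL zL]; split=> //;
    by apply: submx_trans PL; apply: ltmxW.
rewrite !mem_cat => /orP [Ls|Ls] /orP [L's|L's] neq.
- exact: adj1.
- right; right; have [dL PL _] := sP1 _ Ls; have [dL' PL' _] := sP2 _ L's.
  exact: not_dense_cap spl _ _ _ _.
- right; right; have [dL PL _] := sP2 _ Ls; have [dL' PL' _] := sP1 _ L's.
  rewrite capmxC; exact: not_dense_cap spl _ _ _ _.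
- exact: adj2.
Qed.

Definition clique_bounded S (b : {poly F}) : Prop :=
  forall x, exists s, dense_clique (flat S) x s /\ (mup x b <= size s)%N.

(** Take the hyperplanes of [S] through [P1] and those through [P2]. None contains both, as [P1] and
    [P2] span the space; each set is proper because [P1] and [P2] are strictly larger than the
    flat. *)
Lemma splits_by_flats S P1 P2 :
  closed_flat S -> splits_by (flat S) P1 P2 ->
  exists S1 S2, [/\ S = S1 :|: S2, [disjoint S1 & S2],
    [/\ closed_flat S1, S1 \proper S & (P1 <= flat S1)%MS] &
    [/\ closed_flat S2, S2 \proper S & (P2 <= flat S2)%MS]].
Proof.
move=> clS [_ /eqmxP sumP lt1 lt2 split].
pose U P := [set i in S | (P <= hyp i)%MS].
have US P : U P \subset S by apply/subsetP => i; rewrite inE => /andP[].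
have PU P : (P <= flat (U P))%MS by apply/sub_flatP => i; rewrite inE => /andP[].
have UP P : (flat S < P)%MS -> closed_flat (U P) /\ U P \proper S.
  move=> lt; split.
    apply/subsetP => i /flat_closureP Ui; rewrite inE (submx_trans (PU P)) // andbT.
    by apply: (subsetP clS); apply/flat_closureP; apply: submx_trans (flatS (US P)) Ui.
  rewrite properEneq US andbT; apply: contraTneq lt => UE.
  by rewrite ltmxE negb_and negbK -{2}UE PU orbT.
have [cl1 p1] := UP P1 lt1; have [cl2 p2] := UP P2 lt2.
exists (U P1), (U P2); split; rewrite ?PU //.
  apply/eqP; rewrite eqEsubset subUset !US !andbT; apply/subsetP => i iS.
  by have [] := split i (flat_sub_hyp a iS); rewrite !inE iS => ->; rewrite ?orbT.
rewrite -setI_eq0; apply/eqP/setP => i; rewrite !inE; apply/negP.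
case/andP=> /andP[_ P1i] /andP[_ P2i].
have /negP := full_not_sub_hyp i (submx_refl (1%:M : 'M[F]_n)); apply.
by rewrite -sumP addsmx_sub P1i P2i.
Qed.

Theorem exists_bounded_BS S p : closed_flat S -> fixes_forms a p S ->
  exists b, [/\ b != 0, BS_sub a S p b & clique_bounded S b].
Proof.
have empty_case T q : T == set0 ->
    exists b, [/\ b != 0, BS_sub a T q b & clique_bounded T b].
  move=> /eqP ->; exists 1; split; [exact: oner_neq0|exact: BS_sub_set0|].
  by move=> x; exists [::]; rewrite mupNroot ?root1.
move: {2}#|S| (leqnn #|S|) => m; elim: m S p => [|m IH] S p cS clS pS.
  by apply: empty_case; rewrite -cards_eq0 -leqn0.
have IHp T q : T \proper S -> closed_flat T -> fixes_forms a q T ->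
    exists b, [/\ b != 0, BS_sub a T q b & clique_bounded T b].
  move=> /proper_card TS; apply: IH; rewrite -ltnS; exact: leq_trans cS.
have [S0|S0] := eqVneq S set0; first by apply: empty_case; rewrite S0.
have [[P1 [P2 spl]]|nspl] := classic (exists P1 P2, splits_by (flat S) P1 P2).
  have [S1 [S2 [SE dis [cl1 lt1 le1] [cl2 lt2 le2]]]] := splits_by_flats clS spl.
  have [_ sumP _ _ _] := spl.
  have [|||p1 [p2 [fix1 fix2 BSE]]] := @BS_sub_split F n k a S1 S2 P1 P2 p dis sumP.
  - by move=> i /(flat_sub_hyp a); apply: submx_trans le1.
  - by move=> i /(flat_sub_hyp a); apply: submx_trans le2.
  - by rewrite -SE.
  have [b1 [nz1 B1 c1]] := IHp _ _ lt1 cl1 fix1.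
  have [b2 [nz2 B2 c2]] := IHp _ _ lt2 cl2 fix2.
  exists (b1 * b2); split; [exact: mulf_neq0|rewrite SE; exact: BSE|].
  move=> x; have [s1 [cs1 ms1]] := c1 x; have [s2 [cs2 ms2]] := c2 x.
  exists (s1 ++ s2); rewrite size_cat mupM // leq_add //; split=> //.
  by apply: (dense_clique_cat spl); [apply: dense_cliqueW cs1|apply: dense_cliqueW cs2].
(* The flat of [S] is now dense. The list consists of the proper closed subsets, among them the sets
   [S :&: flat_closure T] that the cone step asks for. *)
pose ts := [seq T : {set 'I_k} <- enum {set 'I_k} |
  (flat_closure T \subset T) && (T \proper S)].
have [|c [cnz Hc mc]] := @lcm_mup_seq F _ ts
    (fun T b => BS_sub a T p b /\ clique_bounded T b).
  move=> T; rewrite mem_filter => /andP[/andP[clT TS] _].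
  have [|b [bnz Bb cb]] := IHp T p TS clT; last by exists b.
  by move=> i iT; apply: pS; apply: (subsetP (proper_sub TS)).
have [T TS STn|N [r HB]] := @BS_sub_cone F n k a S p c pS.
  set U := S :&: flat_closure T.
  have [b [[Bb _] bc]] : exists b, (BS_sub a U p b /\ clique_bounded U b) /\ b %| c.
    apply: Hc; rewrite mem_filter mem_enum andbT; apply/andP; split.
      apply/subsetP => i /flat_closureP Ui; rewrite !inE; apply/andP; split.
        apply: (subsetP clS); apply/flat_closureP; apply: submx_trans Ui.
        by apply: flatS; apply: subsetIl.
      apply: submx_trans Ui; apply/sub_flatP => j; rewrite inE.
      by case/andP => _ /flat_closureP.
    apply/properP; split; first exact: subsetIl.
    case/subsetPn: STn => i iS iT.
    by exists i; rewrite // inE (negbTE iT) andbF.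
  by rewrite -(divpK bc); apply: BS_sub_mull.
have Spos : (0 < #|S|)%N by rewrite card_gt0.
exists ((\prod_(j < N) (#|S|%:R *: 'X + (r + j)%:R%:P)) * c); split=> //.
  by apply: mulf_neq0 => //; have [] := mup_arithmetic_prod r N (0 : F) Spos.
move=> x; have [qnz qle qz] := mup_arithmetic_prod r N x Spos.
rewrite mupM //; set q := \prod_(j < N) _ in qnz qle qz *.
(* If [x] is not a root of [c], the empty clique over the empty set serves. *)
have [T [s [TS clT cls ms]]] : exists T s, [/\ T \proper S, closed_flat T,
    dense_clique (flat T) x s & (mup x c <= size s)%N].
  have [c0|cpos] := posnP (mup x c).
    exists set0, [::]; rewrite c0; split=> //; first by rewrite proper0.
    apply/subsetP => i /flat_closureP; rewrite flat_set0.
    by move=> H; have := full_not_sub_hyp i (submx_refl (1%:M : 'M[F]_n)); rewrite H.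
  have [T [b [Tts [_ cb] le]]] := mc x cpos.
  move: Tts; rewrite mem_filter => /andP[/andP[clT TS] _].
  have [s [cls ms]] := cb x; exists T, s; split=> //; exact: leq_trans ms.
have leST : (flat S <= flat T)%MS by apply/flatS/proper_sub.
have [q0|qpos] := posnP (mup x q).
  by exists s; rewrite q0; split=> //; apply: dense_cliqueW cls.
(* [x] is a root of [q], so #|S| x is an integer, and #|S| is the multiplicity of the flat because
   [S] is closed. *)
exists (flat S :: s); split; last by rewrite /= -add1n leq_add.
apply: dense_clique_cons cls => //.
- by split=> //; exists S.
- apply/negP => leTS; case/properP: TS => _ [i iS]; apply/negP; rewrite negbK.
  apply: (subsetP clT); apply/flat_closureP; apply: submx_trans leTS _.
  exact: flat_sub_hyp.
- by rewrite mult_at_flat //; apply: qz.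
Qed.

End DenseFlats.

(** * Comparison with operators in normal form *)

(* These mirror [fmod_eq], [fmod_add], ..., [Dop_act] over an abstract domain
   with derivations, where the ring identities are cheap to check. *)
Section Reach.
Variables (R : idomainType) (n : nat) (s f : R) (del : 'I_n -> R -> R).
Hypothesis del_der : forall i, derivation (del i).
Hypothesis f_neq0 : f != 0.
Implicit Types (u v w : R * nat) (P Q : seq (R * seq 'I_n)).

Definition feq u v : Prop := u.1 * f ^+ v.2 = v.1 * f ^+ u.2.
Definition fadd u v := (u.1 * f ^+ v.2 + v.1 * f ^+ u.2, (u.2 + v.2)%N).
Definition fscale (c : R) u := (c * u.1, u.2).
Definition fder (i : 'I_n) u :=
  (del i u.1 * f + (s - (u.2)%:R) * u.1 * del i f, u.2.+1).
Definition op_act P u :=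
  foldr (fun t acc => fadd (fscale t.1 (foldr fder u t.2)) acc) (0, 0%N) P.

Lemma feq_trans u v w : feq u v -> feq v w -> feq u w.
Proof.
case: u v w => [g m] [h p] [e q]; rewrite /feq /= => E1 E2.
apply: (mulIf (expf_neq0 p f_neq0)).
by rewrite mulrAC E1 mulrAC E2 mulrAC.
Qed.

Lemma feq_fadd u u' v v' : feq u u' -> feq v v' -> feq (fadd u v) (fadd u' v').
Proof.
case: u u' v v' => [g m] [g' m'] [h p] [h' p']; rewrite /feq /= => E1 E2.
rewrite !exprD.
transitivity (g * f ^+ m' * f ^+ p * f ^+ p' + h * f ^+ p' * f ^+ m * f ^+ m').
  by ring.
by rewrite E1 E2; ring.
Qed.

Lemma feq_fscale c u v : feq u v -> feq (fscale c u) (fscale c v).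
Proof. by rewrite /feq /= -!mulrA => ->. Qed.

(** Differentiate the cross-multiplied identity; the extra factor [f] avoids exponents lowered by
    one. *)
Lemma feq_fder i u v : feq u v -> feq (fder i u) (fder i v).
Proof.
case: u v => [g m] [h p]; rewrite /feq /= => E.
have E' : del i (g * f ^+ p) * f = del i (h * f ^+ m) * f by rewrite E.
rewrite !(del_der i).2 !mulrDl in E'.
have D q x : x * del i (f ^+ q) * f = q%:R * (x * f ^+ q) * del i f.
  by rewrite -mulrA (derivation_expM f q (del_der i)); ring.
rewrite !D E in E'.
rewrite !exprS; apply/eqP; rewrite -subr_eq0; apply/eqP.
transitivity (f * (del i g * f ^+ p * f - del i h * f ^+ m * f) +
  f * del i f * ((s - m%:R) * (g * f ^+ p) - (s - p%:R) * (h * f ^+ m))).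
  by ring.
have -> : del i g * f ^+ p * f =
  del i h * f ^+ m * f + m%:R * (h * f ^+ m) * del i f - p%:R * (h * f ^+ m) * del i f.
  by rewrite -E' addrK.
by rewrite E; ring.
Qed.

Lemma op_act_cons t P u :
  op_act (t :: P) u = fadd (fscale t.1 (foldr fder u t.2)) (op_act P u).
Proof. by []. Qed.

Lemma op_act_cat P Q u : feq (fadd (op_act P u) (op_act Q u)) (op_act (P ++ Q) u).
Proof.
elim: P => [|t P IH] /=; first by rewrite /feq /= !expr0 add0n; ring.
apply: feq_trans (feq_fadd (erefl : feq (fscale t.1 (foldr fder u t.2)) _) IH).
by rewrite /feq /= !exprD; ring.
Qed.

Lemma op_act_scale c P u :
  feq (fscale c (op_act P u)) (op_act [seq (c * t.1, t.2) | t <- P] u).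
Proof.
elim: P => [|t P IH] /=; first by rewrite /feq /= !expr0; ring.
apply: feq_trans (feq_fadd
  (erefl : feq (fscale (c * t.1) (foldr fder u t.2)) _) IH).
by rewrite /feq /= !exprD; ring.
Qed.

(** Moving the derivative past a coefficient, d_i c = c d_i + d_i(c), restores the normal form. *)
Lemma op_act_der i P u : exists Q, feq (fder i (op_act P u)) (op_act Q u).
Proof.
elim: P => [|[c w] P [Q IH]].
  by exists [::]; rewrite /feq /= (derivation0 (del_der i)); ring.
exists [:: (del i c, w), (c, i :: w) & Q] => /=.
set v := foldr fder u w.
have E : feq (fder i (fadd (fscale c v) (op_act P u)))
    (fadd (fscale (del i c) v) (fadd (fscale c (fder i v)) (fder i (op_act P u)))).
  case: v (op_act P u) => [g m] [h p]; rewrite /feq /=.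
  rewrite !(del_der i).1 !(del_der i).2 !natrD !(exprD, exprS).
  have Dp := derivation_expM f p (del_der i).
  have Dm := derivation_expM f m (del_der i).
  transitivity (f ^+ m * (f * f ^+ m * (f * f ^+ p)) *
    ((del i c * g + c * del i g) * f ^+ p * f + c * g * (del i (f ^+ p) * f) +
     del i h * f ^+ m * f + h * (del i (f ^+ m) * f) +
     (s - (m%:R + p%:R)) * (c * g * f ^+ p + h * f ^+ m) * del i f)).
    by ring.
  by rewrite Dp Dm; ring.
apply: feq_trans E _; apply: feq_fadd => //; exact: feq_fadd.
Qed.

Definition reach u v : Prop := exists P, feq v (op_act P u).

Lemma reach_feq u v w : feq w v -> reach u v -> reach u w.
Proof. by move=> E [P HP]; exists P; apply: feq_trans HP. Qed.

Lemma reach_refl u : reach u u.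
Proof. by exists [:: (1, [::])]; rewrite /feq /= !expr0 addn0; ring. Qed.

Lemma reach_scale u v c : reach u v -> reach u (fscale c v).
Proof.
case=> P HP; exists [seq (c * t.1, t.2) | t <- P].
exact: feq_trans (feq_fscale c HP) (op_act_scale c P u).
Qed.

Lemma reach_add u g h m : reach u (g, m) -> reach u (h, m) -> reach u (g + h, m).
Proof.
case=> [P HP] [Q HQ]; exists (P ++ Q); apply: feq_trans (op_act_cat P Q u).
apply: feq_trans (feq_fadd HP HQ).
by rewrite /feq /= exprD; ring.
Qed.

Lemma reach_der u v i : reach u v -> reach u (fder i v).
Proof.
case=> P HP; have [Q HQ] := op_act_der i P u.
by exists Q; apply: feq_trans (feq_fder i HP) HQ.
Qed.

(** The rules changing the pole order only rewrite the same fraction; the others are closure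
    properties of the module D[s] f^(s+1). *)
Lemma tgen_reach Ds g m :
  (forall d, Ds d -> exists c : 'I_n -> R, forall x, d x = \sum_j c j * del j x) ->
  tgen s f Ds g m -> reach (f, 0%N) (g, m).
Proof.
move=> DsP; elim=> {g m}.
- exact: reach_refl.
- by move=> g h m _ Hg _ Hh; apply: reach_add.
- by move=> c g m _ H; exact: reach_scale c H.
- move=> d g m /DsP [c dE] _ H.
  have -> : d g * f + (s - m%:R) * g * d f =
      \sum_j c j * (fder j (g, m)).1.
    rewrite !dE mulr_suml mulr_sumr -big_split; apply: eq_bigr => j _ /=; ring.
  elim/big_ind: _ => [|x y|j _].
  + by exists [::]; rewrite /feq /= !mul0r.
  + exact: reach_add.
  + exact: reach_scale (c j) (reach_der j H).
- by move=> g m _; apply: reach_feq; rewrite /feq /= exprS; ring.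
- by move=> g m _; apply: reach_feq; rewrite /feq /= exprS; ring.
Qed.

End Reach.

Lemma coprime_int_multiple (F : numFieldType) (x : F) (m m' : nat) : coprime m m' ->
  (exists z : int, x * m%:R = z%:~R) -> (exists z : int, x * m'%:R = z%:~R) ->
  exists z : int, x = z%:~R.
Proof.
move=> co [z zE] [z' z'E].
have /coprimezP [[u v] /= uv] : coprimez m m' by [].
exists (u * z + v * z').
transitivity (x * (u * m + v * m')%:~R); first by rewrite uv mulr1.
by rewrite !(rmorphD, rmorphM) /= -zE -z'E; ring.
Qed.

(** * Consequences of minimality *)

Section Minimal.
Variables (F : numFieldType) (n k : nat) (a : 'I_k -> 'rV[F]_n).
Local Notation K := {poly {mpoly F[n]}}.

Definition arr : K := (\prod_(i < k) \sum_(j < n) (a i 0 j)%:MP * 'X_j)%:P.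

Definition functional_eq (b : {poly F}) : Prop :=
  reach 'X arr (fun i => map_poly (mderiv i)) (arr, 0%N) (const_poly n b, 0%N).

Hypothesis a_neq0 : forall i, a i != 0.

Lemma lin_poly_neq0 (w : 'rV[F]_n) : w != 0 -> lin_poly w != 0.
Proof.
apply: contraNneq => w0; apply/eqP/rowP => j; rewrite mxE.
have := dir_deriv_lin_poly (delta_mx 0 j) w.
rewrite w0 (derivation0 (dir_deriv_derivation _)) => /esym/eqP.
by rewrite polyC_eq0 mpolyC_eq0 -rowE !mxE => /eqP.
Qed.

Lemma arrE : arr = sub_poly a setT.
Proof.
rewrite /arr /sub_poly rmorph_prod; apply: eq_big => // i.
by rewrite inE.
Qed.

Lemma arr_neq0 : arr != 0.
Proof. by rewrite arrE; apply/prodf_neq0 => i _; apply: lin_poly_neq0. Qed.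

Let der (i : 'I_n) := @map_mderiv_derivation F n i.

Lemma functional_eq_combine b c q r :
  functional_eq b -> functional_eq c -> functional_eq (q * b + r * c).
Proof.
move=> Hb Hc; rewrite /functional_eq /const_poly rmorphD !rmorphM.
apply: (reach_add arr_neq0).
- exact: (reach_scale arr_neq0 (const_poly n q) Hb).
- exact: (reach_scale arr_neq0 (const_poly n r) Hc).
Qed.

Variable b : {poly F}.
Hypothesis b_neq0 : b != 0.
Hypothesis b_eq : functional_eq b.
Hypothesis b_min : forall c, c != 0 -> functional_eq c -> (size b <= size c)%N.

(** The solutions of the functional equation form an ideal, so the remainder of [c] is again a
    solution. *)
Lemma minimal_dvdp c : functional_eq c -> b %| c.
Proof.
move=> Hc; rewrite /dvdp_mod.
have : functional_eq (c %% b).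
  have := functional_eq_combine (- (c %/ b)) 1 b_eq Hc.
  by congr functional_eq; rewrite {2}(divp_eq c b); ring.
move=> Hr; apply/modp_eq0P/eqP; apply: contraT => /b_min /(_ Hr).
by rewrite leqNgt ltn_modp b_neq0.
Qed.

Lemma minimal_clique x :
  exists s, dense_clique a (flat a setT) x s /\ (mup x b <= size s)%N.
Proof.
have [|i _|c [cnz Hc cc]] := @exists_bounded_BS F n k a a_neq0 setT 1%:M.
- exact: subsetT.
- by rewrite mul1mx.
have [s [cs ms]] := cc x; exists s; split=> //; apply: leq_trans ms.
rewrite mup_geq //; apply: dvdp_trans (minimal_dvdp _); first by rewrite -mup_geq.
have : tgen 'X arr (dirs_along 1%:M) (const_poly n c) 0 by rewrite arrE.
apply: (tgen_reach der arr_neq0) => d [v ->].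
by exists (fun j => ((v *m 1%:M) 0 j)%:MP%:P).
Qed.

Lemma mup_comp_oppX x : (mup x (b \Po - 'X) <= mup (- x) b)%N.
Proof.
have XX : (b \Po - 'X) \Po - 'X = b.
  by rewrite -comp_polyA raddfN /= comp_polyX opprK comp_polyXr.
have nz : b \Po - 'X != 0.
  by apply: contraNneq b_neq0 => b0; rewrite -XX b0 comp_poly0.
rewrite mup_geq //.
have : ('X - x%:P) ^+ mup x (b \Po - 'X) %| b \Po - 'X by rewrite -mup_geq.
move/(dvdp_comp_poly (- 'X)); rewrite XX rmorphXn /= comp_polyB comp_polyX comp_polyC.
by move=> H; apply: dvdp_trans H; rewrite polyCN opprK -opprD exprNn dvdp_mull.
Qed.

Lemma minimal_clique_neg x :
  exists s, dense_clique a (flat a setT) x s /\ (mup x (b \Po - 'X) <= size s)%N.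
Proof.
have [s [[us sP adj] ms]] := minimal_clique (- x).
exists s; split; last exact: leq_trans (mup_comp_oppX x) ms.
split=> // L /sP [dL LL [z zE]]; split=> //; exists (- z).
by rewrite rmorphN /= -zE mulNr opprK.
Qed.

End Minimal.

(** * From integrality to roots of unity *)

Lemma cos_sin_mulz (t : Rdefinitions.R) (z : int) :
  cos t = 1 -> sin t = 0 -> cos (t *~ z)%R = 1 /\ sin (t *~ z)%R = 0.
Proof.
move=> ct st.
have nat_case (m : nat) : cos (t *+ m)%R = 1 /\ sin (t *+ m)%R = 0.
  elim: m => [|m [IHc IHs]]; first by rewrite mulr0n -R0E cos_0 sin_0.
  rewrite mulrSr -RplusE cos_plus sin_plus IHc IHs ct st.
  by rewrite !(RmultE, RminusE, RplusE) !(mulr0, mul0r, mulr1, subr0, addr0).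
case: z => m; first exact: nat_case.
rewrite NegzE mulrNz -RoppE cos_neg sin_neg -pmulrn.
by have [-> ->] := nat_case m.+1; rewrite RoppE oppr0.
Qed.

Lemma Complex_cos_sin_exp (t : Rdefinitions.R) (m : nat) :
  (Complex (cos t) (- sin t) : CC) ^+ m = Complex (cos (t *+ m)%R) (- sin (t *+ m)%R).
Proof.
elim: m => [|m IH].
  by rewrite expr0 mulr0n -R0E cos_0 sin_0 R0E oppr0.
rewrite exprSr IH mulrSr -RplusE cos_plus sin_plus.
rewrite !(RmultE, RminusE, RplusE).
apply/eqP; rewrite eq_complex /=; apply/andP; split; apply/eqP; ring.
Qed.

Lemma lam_of_exp (alpha : rat) (m : nat) (z : int) :
  (ratr alpha : CC) * m%:R = z%:~R -> lam_of alpha ^+ m = 1.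
Proof.
move=> E; have {}E : alpha * m%:R = z%:~R.
  apply: (fmorph_inj (@ratr CC)); rewrite rmorphM /= ratr_int.
  by rewrite ratr_nat.
rewrite /lam_of Complex_cos_sin_exp !RmultE.
have -> : (IZR 2 * PI * ratr alpha) *+ m = (IZR 2 * PI : Rdefinitions.R) *~ z.
  rewrite -mulrzr -mulr_natr -mulrA; congr (_ * _).
  by rewrite -(ratr_nat _ m) -rmorphM /= E ratr_int.
by have [-> ->] := cos_sin_mulz z cos_2PI sin_2PI; rewrite oppr0.
Qed.

(** * Transfer to the given definitions over the complex numbers *)

Local Notation C := (complex Rdefinitions.R).

Section Complex.
Variables (n k : nat) (a : 'I_k -> 'rV[CC]_n).
Local Notation K := {poly {mpoly C[n]}}.
Local Notation del := (fun i : 'I_n => map_poly (mderiv i) : K -> K).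

Local Notation f := (Fp a : K).

Lemma FpE : Fp a = arr (F := C) a.
Proof. reflexivity. Qed.

Lemma fmod_eqE u v : fmod_eq a u v = feq (R := K) f u v.
Proof. reflexivity. Qed.

Lemma fmod_addE u v : fmod_add a u v = fadd (R := K) f u v.
Proof. reflexivity. Qed.

Lemma fmod_derivE i u : fmod_deriv a i u = fder (R := K) 'X f del i u.
Proof.
rewrite /fder; have -> : del i f = (mderiv i (arr_poly a))%:P.
  by rewrite map_polyC.
reflexivity.
Qed.

Lemma foldr_derivE u w : foldr (fmod_deriv a) u w = foldr (fder (R := K) 'X f del) u w.
Proof. by elim: w => [//|i w IHw]; rewrite [LHS]/= IHw fmod_derivE. Qed.

Lemma Dop_actE P u : Dop_act a P u = op_act (R := K) 'X f del P u.
Proof.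
elim: P => [|t P IH]; first reflexivity.
transitivity (fmod_add a (fmod_scale t.1 (foldr (fmod_deriv a) u t.2)) (Dop_act a P u)).
  reflexivity.
by rewrite op_act_cons -IH -foldr_derivE; exact: fmod_addE.
Qed.

Lemma BS_functional_eqE b : BS_functional_eq a b <-> functional_eq (F := C) a b.
Proof.
by rewrite /functional_eq -FpE; split=> -[P HP]; exists P; move: HP;
  rewrite fmod_eqE Dop_actE.
Qed.

End Complex.

(** All three claims are read off from these cliques. Here [x] is an arbitrary complex number, so
    rationality of the roots is a consequence. *)
Lemma arrangement_clique n k (a : 'I_k -> 'rV[CC]_n) (b : {poly CC}) :
  reduced_arrangement a -> is_BS_poly a b -> forall x : CC, exists s,
    [/\ uniq s, (mup x (neg_var b) <= size s)%N,
      forall L, L \in s -> dense_edge a L /\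
        exists z : int, x * (mult_edge a L)%:R = z%:~R &
      forall L L', L \in s -> L' \in s -> L != L' -> strongly_adjacent a L L'].
Proof.
move=> [a0 _] [bmon [beq bmin]] x.
have b0 : b != 0 by apply: monic_neq0.
have [s [[us sP adj] ms]] := @minimal_clique_neg C n k a a0 b b0
  (proj1 (BS_functional_eqE a b) beq)
  (fun c c0 ceq => bmin c c0 (proj2 (BS_functional_eqE a c) ceq)) x.
exists s; split=> // L /sP [dL _ zL]; split; [exact: dL|exact: zL].
Qed.

Theorem theorem2 (n k : nat) (a : 'I_k -> 'rV[CC]_n) (b : {poly CC}) :
  reduced_arrangement a ->
  is_BS_poly a b ->
  (* m_alpha <= m(lambda), lambda = exp(-2 pi i alpha) *)
  (forall alpha : rat, 0 < alpha ->
     m_lam_ge a (lam_of alpha) (mup (ratr alpha : CC) (neg_var b)))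
  /\
  (* R_f is contained in the union over dense edges L of Z m_L^{-1} *)
  (forall alpha : CC, root (neg_var b) alpha ->
     exists L : 'M[CC]_n, dense_edge a L /\
       exists z : int, alpha * (mult_edge a L)%:R = z%:~R)
  /\
  (* simplicity of non-integral roots under the gcd condition *)
  ((forall L L' : 'M[CC]_n, dense_edge a L -> dense_edge a L' -> L != L' ->
      ((L <= L')%MS \/ ~ dense_edge a <<(L :&: L')>>%MS) ->
      coprime (mult_edge a L) (mult_edge a L')) ->
   forall alpha : CC, root (neg_var b) alpha ->
     ~ (exists z : int, alpha = z%:~R) ->
     mup alpha (neg_var b) = 1%N).
Proof.
move=> red bBS; have clique := arrangement_clique red bBS.
have root_mup (x : CC) : root (neg_var b) x -> (0 < mup x (neg_var b))%N.
  move=> rx; rewrite -XsubC_dvd ?dvdp_XsubCl //.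
  have [/monic_neq0 b0 _] := bBS; rewrite /neg_var; apply: contraNneq b0 => nb0.
  have := congr1 (fun p : {poly CC} => p \Po - 'X) nb0.
  by rewrite -comp_polyA raddfN /= comp_polyX opprK comp_polyXr comp_poly0 => ->.
split; [|split].
- move=> alpha _; have [s [us ms sP adj]] := clique (ratr alpha).
  exists s; split=> // L /sP [dL [z zE]]; split=> //.
  exact: lam_of_exp zE.
(* A root has positive multiplicity, so its clique has a member. *)
- move=> x /root_mup mpos; have [[|L s] [_ ms sP _]] := clique x.
    by move: mpos; rewrite ltnNge ms.
  by exists L; apply: sP; apply: mem_head.
move=> cop x /root_mup mpos xZ; apply/eqP; rewrite eqn_leq mpos andbT.
have [s [us ms sP adj]] := clique x; apply: leq_trans ms _.
(* Two distinct members would have coprime multiplicities, and Bezout would make [x] an integer. *)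
case: s us sP adj => [|L [|L' s]] // us sP adj; case: xZ.
have neq : L != L' by move: us; rewrite /= inE negb_or -andbA => /andP[].
have [dL zL] := sP L (mem_head _ _).
have L's : L' \in [:: L, L' & s] by rewrite !inE eqxx orbT.
have [dL' zL'] := sP L' L's.
have [le|[le|nd]] := adj L L' (mem_head _ _) L's neq.
- by apply: coprime_int_multiple zL zL'; apply: cop => //; left.
- apply: coprime_int_multiple zL' zL; apply: cop => //; last by left.
  by rewrite eq_sym.
- by apply: coprime_int_multiple zL zL'; apply: cop => //; right.
Qed.
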